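(* For each integer $k\ge 3$, there are infinitely many connected unweighted signed graphs $\tilde G$ such that the underlying unsigned graph has maximum degree $k$ and perfect state transfer occurs in $\tilde G$ between a plus state and a pair state at time $\frac{\pi}{2}$.
   Context: An unweighted signed graph has all edge weights in $\{1,-1\}$ (with at least one of each sign); its underlying graph replaces all weights by $1$. Its adjacency matrix $A$ has $A_{a,b}$ equal to the weight of edge $\{a,b\}$ (and $0$ otherwise), and $U(t)=\exp(itA)$. There is perfect state transfer between unit vectors $\mathbf u,\mathbf v$ at $\tau$ if $U(\tau)\mathbf u=\gamma\mathbf v$ for some $\gamma\in\mathbb C$. A plus state is $\frac1{\sqrt2}(\mathbf e_a+\mathbf e_b)$ and a pair state is $\frac1{\sqrt2}(\mathbf e_a-\mathbf e_b)$, with $a\ne b$ vertices and $\mathbf e_a$ standard basis vectors. *)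

(* Defs.v *)
From HB Require Import structures.
From mathcomp Require Import all_boot all_order all_algebra.
From mathcomp Require Import complex.
From mathcomp Require Import all_classical all_reals all_analysis.
Set Implicit Arguments.
Unset Strict Implicit.
Unset Printing Implicit Defensive.
Import Order.TTheory GRing.Theory Num.Theory.
Import numFieldNormedType.Exports.
Local Open Scope ring_scope.
Local Open Scope complex_scope.

Record signed_graph := SignedGraph {
  sg_order : nat;
  sg_edge : rel 'I_sg_order;
  sg_wt : 'I_sg_order -> 'I_sg_order -> int;
  sg_edge_sym : symmetric sg_edge;
  sg_edge_irr : irreflexive sg_edge;
  sg_wt_sym : forall a b, sg_wt a b = sg_wt b a;
  sg_wt_sign : forall a b, sg_edge a b -> sg_wt a b = 1 \/ sg_wt a b = -1;
  sg_wt_pos : exists a b, sg_edge a b /\ sg_wt a b = 1;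
  sg_wt_neg : exists a b, sg_edge a b /\ sg_wt a b = -1 }.

Definition sg_connected (G : signed_graph) : Prop :=
  forall a b, connect (@sg_edge G) a b.

Definition sg_degree (G : signed_graph) (a : 'I_(sg_order G)) : nat :=
  #|[pred b | sg_edge a b]|.

Definition sg_max_degree (G : signed_graph) : nat :=
  \max_(a < sg_order G) sg_degree a.

(* Weights are only compared on edges: [sg_wt] carries no information
   elsewhere. *)
Definition sg_isomorphic (G H : signed_graph) : Prop :=
  exists f : 'I_(sg_order G) -> 'I_(sg_order H),
    [/\ bijective f,
        forall a b, sg_edge (f a) (f b) = sg_edge a b &
        forall a b, sg_edge a b -> sg_wt (f a) (f b) = sg_wt a b].

(* The limit is taken entrywise, in the topology of K given by its norm; for
   K = R[i] this is the usual topology of the complex numbers. *)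
Definition expmx (K : numFieldType) (n : nat) (M : 'M[K]_n) : 'M[K]_n :=
  lim (series (fun k : nat => (k`!%:R)^-1 *: M ^+ k) @ \oo)%classic.

Section States.
Variable R : realType.

Definition sg_adjacency (G : signed_graph) : 'M[R[i]]_(sg_order G) :=
  \matrix_(a, b) if sg_edge a b then (sg_wt a b)%:~R else 0.

Definition transition_matrix (n : nat) (A : 'M[R[i]]_n) (t : R) : 'M[R[i]]_n :=
  expmx (('i * t%:C) *: A).

Definition perfect_state_transfer (n : nat) (A : 'M[R[i]]_n) (tau : R)
    (u v : 'cV[R[i]]_n) : Prop :=
  exists gamma : R[i], transition_matrix A tau *m u = gamma *: v.

Definition std_basis (n : nat) (a : 'I_n) : 'cV[R[i]]_n := delta_mx a 0.

Definition is_plus_state (n : nat) (u : 'cV[R[i]]_n) : Prop :=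
  exists a b : 'I_n, a != b /\
    u = (sqrtC 2)^-1 *: (std_basis a + std_basis b).

Definition is_pair_state (n : nat) (u : 'cV[R[i]]_n) : Prop :=
  exists a b : 'I_n, a != b /\
    u = (sqrtC 2)^-1 *: (std_basis a - std_basis b).

End States.

(* Main.v *)
(* If a real symmetric A swaps two vectors u and v, then u + v and u - v are
   eigenvectors for 1 and -1, so exp(i (pi/2) A) multiplies them by i and -i and
   maps u to i v.  Take the path c - a - w - b - d with the edges at b negative and
   all other edges positive: A swaps e_a + e_b with e_c - e_d, because the two
   contributions at w cancel.  Anything attached at w alone leaves this unchanged,
   so k - 2 further branches at w, one of them prolonged to an arbitrarily long
   path, give infinitely many trees of maximum degree k. *)
Require Import Defs.
From mathcomp Require Import all_boot all_order all_algebra.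
From mathcomp Require Import complex ring zify.
From mathcomp Require Import all_classical all_reals all_analysis.
Import Order.TTheory GRing.Theory Num.Theory.
Import numFieldNormedType.Exports.
Local Open Scope ring_scope.

(** * Matrix exponential on eigenvectors and on swapped pairs *)

Section MatrixExponential.
Variables (K : numFieldType) (n : nat).
Local Open Scope classical_set_scope.

Lemma cvg_mx_coord (S : nat -> 'M[K]_n) (L : 'M[K]_n) :
  (forall i j, S k i j @[k --> \oo] --> L i j) -> S k @[k --> \oo] --> L.
Proof.
move=> cvgS; apply/cvg_ballP => e e0.
have : \forall k \near \oo, forall i j, ball (L i j) e (S k i j).
  apply: filter_forall => i; apply: filter_forall => j.
  refine (cvg_ball (cvgS i j) e0).
by apply: filterS => k SL; split.
Qed.

(** Each partial sum acts on [w] as the scalar partial sum, and multiplying by [w] is continuous in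
    each entry, so uniqueness of limits applies. Convergence is assumed because [expmx] is a [lim],
    a meaningless default value for a divergent series. *)
Lemma expmx_eigenvector (M : 'M[K]_n) (w : 'cV[K]_n) (z e : K) :
    cvg (series (fun k : nat => (k`!%:R)^-1 *: M ^+ k) @ \oo) ->
    M *m w = z *: w ->
    series (fun k : nat => z ^+ k / k`!%:R) k @[k --> \oo] --> e ->
  expmx M *m w = e *: w.
Proof.
set S := series _ => cvgS Mw cvge; rewrite /expmx -/S.
have Mkw k : M ^+ k *m w = z ^+ k *: w.
  elim: k => [|k IHk]; first by rewrite !expr0 mul1mx scale1r.
  by rewrite exprSr -mulmxE -mulmxA Mw -scalemxAr IHk scalerA -exprS.
have Sw k : S k *m w = series (fun k : nat => z ^+ k / k`!%:R) k *: w.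
  rewrite /S /series /= mulmx_suml scaler_suml; apply: eq_bigr => l _.
  by rewrite -scalemxAl Mkw scalerA mulrC.
apply/colP => i.
have SLw : (S k *m w) i 0 @[k --> \oo] --> (lim (S @ \oo) *m w) i 0.
  rewrite (_ : (fun k => _) = fun k => \sum_j S k i j * w j 0); last first.
    by apply/funext => k; rewrite mxE.
  rewrite mxE; apply: cvg_big; first exact: add_continuous.
  move=> j _; apply: cvgMl => //.
  exact: (cvg_comp _ _ cvgS (@coord_continuous K n n i j _)).
apply: (cvg_unique _ SLw); first exact: norm_hausdorff.
rewrite mxE (_ : (fun k => _) =
    fun k => series (fun k : nat => z ^+ k / k`!%:R) k * w i 0).
  exact: cvgMl.
by apply/funext => k; rewrite Sw mxE.
Qed.

(** The last two hypotheses say that exp(z) = c and exp(-z) = -c. Then 2u = (u + v) + (u - v) is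
    sent to c(u + v) - c(u - v) = 2cv. *)
Lemma expmx_swap (A : 'M[K]_n) (u v : 'cV[K]_n) (z c : K) :
    A *m u = v -> A *m v = u ->
    cvg (series (fun k : nat => (k`!%:R)^-1 *: (z *: A) ^+ k) @ \oo) ->
    series (fun k : nat => z ^+ k / k`!%:R) k @[k --> \oo] --> c ->
    series (fun k : nat => (- z) ^+ k / k`!%:R) k @[k --> \oo] --> - c ->
  expmx (z *: A) *m u = c *: v.
Proof.
move=> Auv Avu cvgA cvgz cvgNz; set E := expmx _.
have Euv : E *m (u + v) = c *: (u + v).
  apply: expmx_eigenvector cvgA _ cvgz.
  by rewrite -scalemxAl mulmxDr Auv Avu addrC.
have Evu : E *m (u - v) = - c *: (u - v).
  apply: expmx_eigenvector cvgA _ cvgNz.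
  by rewrite -scalemxAl mulmxBr Auv Avu scaleNr -scalerN opprB.
have two_neq0 : (2 : K) != 0 by rewrite pnatr_eq0.
apply: (scalerI two_neq0); rewrite scalemxAr.
have -> : 2 *: u = (u + v) + (u - v).
  by rewrite addrACA subrr addr0 scaler_nat mulr2n.
rewrite mulmxDr Euv Evu scaleNr -scalerBr.
have -> : u + v - (u - v) = 2 *: v.
  by rewrite opprB addrC addrA subrK scaler_nat mulr2n.
by rewrite !scalerA mulrC.
Qed.

(** The sum of the norms of all entries bounds every row sum, so each further factor [M] costs at
    most one factor of it. This allows comparison with a scalar exponential series. *)
Lemma norm_exprmx_coord (M : 'M[K]_n) (k : nat) (i j : 'I_n) :
  `|(M ^+ k) i j| <= (\sum_i \sum_j `|M i j|) ^+ k.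
Proof.
elim: k i j => [|k IHk] i j.
  by rewrite [M ^+ 0]/(1%:M) mxE expr0 normr_nat lern1 leq_b1.
set c := \sum_i \sum_j _.
have c0 : 0 <= c by rewrite sumr_ge0 // => ? _; rewrite sumr_ge0.
rewrite exprS -mulmxE mxE (le_trans (ler_norm_sum _ _ _)) //.
rewrite exprS (@le_trans _ _ (\sum_l `|M i l| * c ^+ k)) //.
  by apply: ler_sum => l _; rewrite normrM ler_wpM2l.
rewrite -mulr_suml ler_wpM2r ?exprn_ge0 //.
by rewrite [leRHS](bigD1 i) //= lerDl sumr_ge0 // => ? _; rewrite sumr_ge0.
Qed.

End MatrixExponential.

(** * Convergence of complex series and Euler's formula *)

Section ComplexSeries.
Variable R : realType.
Local Open Scope complex_scope.
Local Open Scope classical_set_scope.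
Let C : numFieldType := R[i].

Lemma cvg_complex (a b : nat -> R) (x y : R) :
    a k @[k --> \oo] --> x -> b k @[k --> \oo] --> y ->
  (a k +i* b k : C) @[k --> \oo] --> (x +i* y : C).
Proof.
move=> cvga cvgb; apply/cvgrPdist_lt => e.
(* A positive element of [R[i]] has zero imaginary part, so its real part can be halved to bound
   each coordinate. *)
rewrite ltcE => /andP[/eqP/= e1 e0].
have e20 : 0 < complex.Re e / 2 by rewrite divr_gt0.
move/cvgrPdist_lt: cvga => /(_ _ e20) cvga.
move/cvgrPdist_lt: cvgb => /(_ _ e20) cvgb.
near=> k.
have ak : `|x - a k| < complex.Re e / 2 by near: k.
have bk : `|y - b k| < complex.Re e / 2 by near: k.
rewrite [_ - _]complexE (le_lt_trans (ler_normD _ _)) // normrM.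
have -> : `|'i%C| = 1 :> R[i] by rewrite normc_def /= expr0n expr1n add0r sqrtr1.
rewrite mul1r !normc_def /= !expr0n !addr0 !sqrtr_sqr.
rewrite ltcE /= e1 addr0 eqxx /= [ltRHS]splitr ltrD //.
Unshelve. all: by end_near. Qed.

(** Real and imaginary parts are bounded by the modulus, so the comparison test over [R] applies to
    both. *)
Lemma cvg_series_complex (u : nat -> C) (v : nat -> R) :
    (forall k, `|u k| <= (v k)%:C) -> cvg (series v @ \oo) ->
  cvg (series u @ \oo).
Proof.
move=> uv cvgv.
have seriesE k : series u k =
    series (fun l => complex.Re (u l)) k +i* series (fun l => complex.Im (u l)) k.
  rewrite /series /=; elim: k => [|k IHk]; first by rewrite !big_nil.
  by rewrite !big_nat_recr //= IHk; case: (u k).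
have v0 k : 0 <= v k by rewrite -ler0c (le_trans _ (uv k)).
have cvgw (w : nat -> R) : (forall k, `|w k|%:C <= `|u k|) -> cvg (series w @ \oo).
  move=> wu; apply: normed_cvg; apply: series_le_cvg cvgv => //= k.
  by rewrite -lecR (le_trans (wu k)).
have cvgRe : cvg (series (fun l => complex.Re (u l)) @ \oo).
  by apply: cvgw => k; exact: normc_ge_Re.
have cvgIm : cvg (series (fun l => complex.Im (u l)) @ \oo).
  apply: cvgw => k; rewrite normc_def lecR -sqrtr_sqr ler_sqrt ?lerDr ?sqr_ge0 //.
  by rewrite addr_ge0 ?sqr_ge0.
apply/cvg_ex; exists (lim (series (fun l => complex.Re (u l)) @ \oo) +i*
  lim (series (fun l => complex.Im (u l)) @ \oo) : C).
rewrite (funext seriesE).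
exact: cvg_complex.
Qed.

Lemma cvg_expmx n (M : 'M[C]_n) :
  cvg (series (fun k : nat => (k`!%:R)^-1 *: M ^+ k) @ \oo).
Proof.
have cvgM i j : cvg (series (fun k : nat => (k`!%:R)^-1 * (M ^+ k) i j) @ \oo).
  set c : C := \sum_i \sum_j `|M i j|.
  (* The bound is a sum of norms, hence real, and the dominating series is the real exponential
     series at its real part. *)
  have cRe : c = (complex.Re c)%:C.
    rewrite RRe_real // ger0_real // sumr_ge0 // => ? _.
    by rewrite sumr_ge0.
  apply: (cvg_series_complex _ _ _ (is_cvg_series_exp_coeff (complex.Re c))) => k.
  rewrite /exp_coeff /= normrM mulrC rmorphM rmorphXn /= -cRe fmorphV /=.
  rewrite rmorph_nat normfV normr_nat ler_wpM2r //.
  exact: norm_exprmx_coord.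
apply/cvg_ex; exists (\matrix_(i, j)
  lim (series (fun k : nat => (k`!%:R)^-1 * (M ^+ k) i j) @ \oo)).
apply: cvg_mx_coord => i j; rewrite mxE; have := cvgM i j.
rewrite (_ : series _ = fun k =>
  series (fun k => (k`!%:R)^-1 *: M ^+ k) k i j) //.
apply/funext => k; rewrite /series /= summxE.
by apply: eq_bigr => l _; rewrite mxE.
Qed.

Lemma cvg_series_expi (t : R) :
  series (fun k : nat => ('i * t%:C) ^+ k / k`!%:R : C) k @[k --> \oo]
    --> (cos t +i* sin t : C).
Proof.
rewrite (_ : series _ = fun k => series (cos_coeff t) k +i* series (sin_coeff t) k).
  rewrite cos.unlock sin.unlock.
  exact: (cvg_complex _ _ _ _ (@is_cvg_series_cos_coeff _ t)
    (@is_cvg_series_sin_coeff _ t)).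
apply/funext => k; rewrite /series /=.
elim: k => [|k IHk]; first by rewrite !big_nil.
rewrite !big_nat_recr //= IHk.
have -> : ('i * t%:C) ^+ k / k`!%:R = cos_coeff t k +i* sin_coeff t k :> C.
  (* Even powers of i are real and odd ones imaginary, with exactly the parity factors and signs of
     [cos_coeff] and [sin_coeff]. *)
  have iX : 'i ^+ k = ((~~ odd k)%:R * (-1) ^+ k./2) +i* ((odd k)%:R * (-1) ^+ k.-1./2) :> R[i].
    elim: k {IHk} => [|k IHk]; first by rewrite expr0 /= !mul1r mul0r.
    rewrite exprSr IHk; case: (boolP (odd k)) => ok /=; simpc.
      rewrite ok /= mul1r mul0r.
      by case: k ok {IHk} => // k _; rewrite /= exprS mulN1r.
    by rewrite (negbTE ok) /= mul0r mul1r.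
  rewrite exprMn iX -rmorphXn -(rmorph_nat (real_complex R)) -fmorphV -mulrA -rmorphM.
  by rewrite /cos_coeff /sin_coeff /=; simpc; rewrite !mulrA.
by [].
Qed.

End ComplexSeries.

Lemma perfect_state_transfer_swap (R : realType) (n : nat) (A : 'M[R[i]]_n)
    (u v : 'cV[R[i]]_n) :
  A *m u = v -> A *m v = u -> perfect_state_transfer A (pi / 2) u v.
Proof.
move=> Auv Avu; exists 'i%C; rewrite /transition_matrix.
apply: (@expmx_swap R[i] _ _ _ _ ('i%R * (pi / 2)%:C%C)) => //.
- exact: cvg_expmx.
- by have := @cvg_series_expi R (pi / 2); rewrite cos_pihalf sin_pihalf.
(* The series at the opposite exponent is Euler's formula at -pi/2, with sum -i. *)
have := @cvg_series_expi R (- (pi / 2)).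
rewrite cosN sinN cos_pihalf sin_pihalf rmorphN mulrN.
by rewrite (_ : Complex 0 (-1) = - 'i%C :> R[i]) //=; simpc.
Qed.

(** * The signed trees: edges, degrees and connectedness *)

Section Tree.
Variable m : nat.
Local Open Scope nat_scope.

(* The vertices w, a, b, c, d are 0, 1, 2, 3, 4; the branches at w start at
   5, ..., m + 5 and the last one continues as the path m + 5, m + 6, ... *)
Definition tree_parent (j : nat) : nat :=
  if j <= 2 then 0 else if j <= 4 then j - 2 else if j < m + 6 then 0 else j.-1.

(** The strict inequalities exclude a loop at the root 0, which [tree_parent] sends to itself. *)
Definition tree_edge (x y : nat) : bool :=
  (x < y) && (x == tree_parent y) || (y < x) && (y == tree_parent x).

Definition tree_weight (x y : nat) : int :=
  if (x == 2) || (y == 2) then (-1)%R else 1%R.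

Lemma tree_edge_sym x y : tree_edge x y = tree_edge y x.
Proof. by rewrite /tree_edge orbC. Qed.

Lemma tree_edge_irr x : tree_edge x x = false.
Proof. by rewrite /tree_edge ltnn. Qed.

Lemma tree_weight_sym x y : tree_weight x y = tree_weight y x.
Proof. by rewrite /tree_weight orbC. Qed.

Lemma tree_edge_parent x : 0 < x -> tree_parent x < x /\ tree_edge (tree_parent x) x.
Proof.
move=> x0; suff px : tree_parent x < x by rewrite /tree_edge px eqxx.
by rewrite /tree_parent; do ?[case: ifP => ?]; lia.
Qed.

Lemma tree_edge1 x : tree_edge x 1 = (x == 0) || (x == 3).
Proof. by rewrite /tree_edge /tree_parent /=; do ?[case: ifP => ?]; lia. Qed.

Lemma tree_edge2 x : tree_edge x 2 = (x == 0) || (x == 4).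
Proof. by rewrite /tree_edge /tree_parent /=; do ?[case: ifP => ?]; lia. Qed.

Lemma tree_edge3 x : tree_edge x 3 = (x == 1).
Proof. by rewrite /tree_edge /tree_parent /=; do ?[case: ifP => ?]; lia. Qed.

Lemma tree_edge4 x : tree_edge x 4 = (x == 2).
Proof. by rewrite /tree_edge /tree_parent /=; do ?[case: ifP => ?]; lia. Qed.

(** Only the root branches: 1 and 2 have the child x + 2, vertices from m + 5 on can only have x +
    1, and the others are leaves, for which the second entry is a mere placeholder. *)
Lemma tree_edge_child x y : 0 < x -> tree_edge x y ->
  y \in [:: tree_parent x; if x <= 2 then x.+2 else x.+1].
Proof.
move=> x0; rewrite !inE /tree_edge => /orP[/andP[xy /eqP]|/andP[_ ->] //].
by rewrite {1}/tree_parent; do ?[case: ifP => ?]; lia.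
Qed.

Lemma tree_degree0 i : count (tree_edge 0) (iota 0 (m + i).+4.+2) = m.+3.
Proof.
(* Three blocks: the five vertices of the core path give the neighbours 1 and 2, the m + 1 branch
   starts are all neighbours, and the i vertices prolonging the last branch are not. *)
have -> : (m + i).+4.+2 = 5 + (m.+1 + i) by lia.
rewrite 2!iotaD !count_cat.
have /eqP -> : count (tree_edge 0) (iota (0 + 5) m.+1) == m.+1.
  rewrite -[X in _ == X](size_iota (0 + 5)) -all_count; apply/allP => y.
  by rewrite mem_iota /tree_edge /tree_parent; do ?[case: ifP => ?]; lia.
have -> : count (tree_edge 0) (iota (0 + 5 + m.+1) i) = 0.
  apply/eqP; rewrite -leqn0 leqNgt -has_count; apply/hasPn => y.
  by rewrite mem_iota /tree_edge /tree_parent; do ?[case: ifP => ?] => /=; lia.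
by rewrite addn0.
Qed.

Lemma tree_degree_le i x : count (tree_edge x) (iota 0 (m + i).+4.+2) <= m.+3.
Proof.
case: (posnP x) => [-> | x0]; first by rewrite tree_degree0.
rewrite -size_filter (@leq_trans 2) //.
apply: (@uniq_leq_size _ _ [:: tree_parent x; if x <= 2 then x.+2 else x.+1]).
  by rewrite filter_uniq ?iota_uniq.
by move=> y; rewrite mem_filter => /andP[/(tree_edge_child _ _ x0)].
Qed.

Variable i : nat.
Let N := (m + i).+4.+2.

Lemma tree_graph_weight_sign (a b : 'I_N) :
  tree_edge a b -> tree_weight a b = 1%R \/ tree_weight a b = (-1)%R.
Proof. by rewrite /tree_weight; case: ifP; [right|left]. Qed.

Lemma tree_graph_pos : exists a b : 'I_N, tree_edge a b /\ tree_weight a b = 1%R.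
Proof. by exists (@Ordinal N 0 isT), (@Ordinal N 1 isT). Qed.

Lemma tree_graph_neg : exists a b : 'I_N, tree_edge a b /\ tree_weight a b = (-1)%R.
Proof. by exists (@Ordinal N 0 isT), (@Ordinal N 2 isT). Qed.

Definition tree_graph : signed_graph :=
  @SignedGraph N (fun a b => tree_edge a b) (fun a b => tree_weight a b)
    (fun a b => tree_edge_sym a b) (fun a => tree_edge_irr a)
    (fun a b => tree_weight_sym a b) tree_graph_weight_sign
    tree_graph_pos tree_graph_neg.

(** Parents are strictly smaller, so strong induction joins every vertex to the root. *)
Lemma tree_graph_connected : sg_connected tree_graph.
Proof.
have sym : connect_sym (@sg_edge tree_graph).
  by apply: sym_connect_sym => a b; exact: tree_edge_sym.
have conn0 (a : 'I_N) : connect (@sg_edge tree_graph) (ord0 : 'I_N) a.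
  have [j ja] := ubnP (val a); elim: j a ja => // j IHj a ja.
  have [a0|a0] := posnP a; first by rewrite (_ : a = ord0) //; apply/val_inj.
  have [pa ea] := tree_edge_parent _ a0.
  apply: (@connect_trans _ _ (Ordinal (ltn_trans pa (ltn_ord a)))).
    by apply: IHj; rewrite /= (leq_trans pa).
  exact: connect1.
by move=> a b; rewrite (connect_trans _ (conn0 b)) // sym.
Qed.

Lemma tree_graph_degree (a : 'I_N) :
  @sg_degree tree_graph a = count (tree_edge a) (iota 0 N).
Proof.
rewrite /sg_degree cardE /enum_mem size_filter -enumT -val_enum_ord count_map.
exact: eq_count.
Qed.

Lemma tree_graph_max_degree : sg_max_degree tree_graph = m.+3.
Proof.
apply/eqP; rewrite eqn_leq; apply/andP; split.
  by apply/bigmax_leqP => a _; rewrite tree_graph_degree tree_degree_le.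
rewrite -[X in X <= _](tree_degree0 i).
by rewrite -(tree_graph_degree ord0) leq_bigmax.
Qed.

End Tree.

(** * The adjacency matrix swaps the two states *)

Section TreeTransfer.
Variables (R : realType) (m i : nat).
Let N := (m + i).+4.+2.
Let A := sg_adjacency R (tree_graph m i).
Let e (j : nat) (jN : (j < N)%N) : 'cV[R[i]]_N := std_basis R (Ordinal jN).

Lemma tree_adjacency_basis j (jN : (j < N)%N) (x : 'I_N) :
  (A *m e j jN) x 0 = if tree_edge m x j then (tree_weight x j)%:~R else 0.
Proof. by rewrite -colE !mxE. Qed.

Lemma tree_adjacency_plus :
  A *m (e 1 isT + e 2 isT) = e 3 isT - e 4 isT.
Proof.
apply/colP => x; rewrite mulmxDr mxE !tree_adjacency_basis !mxE.
rewrite tree_edge1 tree_edge2 /tree_weight -!val_eqE /= !andbT.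
(* Row 0 receives 1 and -1, which cancel; rows from 5 on vanish, as no branch meets 1 or 2. *)
case: x => [[|[|[|[|[|x]]]]] xN] //=; ring.
Qed.

Lemma tree_adjacency_pair :
  A *m (e 3 isT - e 4 isT) = e 1 isT + e 2 isT.
Proof.
apply/colP => x; rewrite mulmxBr mxE [X in _ + X = _]mxE !tree_adjacency_basis !mxE.
rewrite tree_edge3 tree_edge4 /tree_weight -!val_eqE /= !andbT.
(* In row 2 the negative weight of the edge to 4 offsets the minus sign of the pair, giving 1. *)
case: x => [[|[|[|[|[|x]]]]] xN] //=; ring.
Qed.

Lemma tree_transfer : exists u v : 'cV[R[i]]_N,
  [/\ is_plus_state u, is_pair_state v & perfect_state_transfer A (pi / 2) u v].
Proof.
exists ((sqrtC 2)^-1 *: (e 1 isT + e 2 isT)).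
exists ((sqrtC 2)^-1 *: (e 3 isT - e 4 isT)); split.
- by exists (@Ordinal N 1 isT), (@Ordinal N 2 isT).
- by exists (@Ordinal N 3 isT), (@Ordinal N 4 isT).
apply: perfect_state_transfer_swap; rewrite -scalemxAr.
  by rewrite tree_adjacency_plus.
by rewrite tree_adjacency_pair.
Qed.

End TreeTransfer.

Theorem theorem5p5 (R : realType) (k : nat) (hk : (3 <= k)%N) :
  exists G : nat -> signed_graph,
    (forall i j : nat, sg_isomorphic (G i) (G j) -> i = j) /\
    (forall i : nat,
       [/\ sg_connected (G i),
           sg_max_degree (G i) = k &
           exists u v : 'cV[R[i]]_(sg_order (G i)),
             [/\ is_plus_state u, is_pair_state v &
                 perfect_state_transfer (sg_adjacency R (G i)) (pi / 2) u v]]).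
Proof.
(* With k = m + 3, the family is indexed by the number of vertices prolonging the last branch. An
   isomorphism preserves the order m + i + 6, which determines i. *)
case: k hk => [|[|[|m]]] // _; exists (tree_graph m); split=> [i j|i].
  case=> f [/bij_eq_card]; rewrite !card_ord => /eqP.
  by rewrite !eqSS eqn_add2l => /eqP.
split; first exact: tree_graph_connected.
  exact: tree_graph_max_degree.
exact: tree_transfer.
Qed.
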